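(* Consider the one-dimensional multi-ion GLM-MHD system with the entropy-conservative two-point flux $\hat{\mathbf f}^{\mathrm{EC}}$, the two-point non-conservative term $\mathbf\Phi^{\diamond,\mathrm{EC}}$, and the nodal discontinuous Galerkin scheme on one element of polynomial degree $N$, all as defined in the context. (a) (Entropy conservation) If $\hat{\mathbf f}^{\mathrm{EC}}$ and $\mathbf\Phi^{\diamond,\mathrm{EC}}$ are used both in the volume terms and in the surface terms of the scheme, then $$\sum_{j=0}^NJ\omega_j\,\mathbf w_j^T\dot{\mathbf u}_j=\hat f^S_{(0,L)}-\hat f^S_{(N,R)},$$ where $\hat f^S$ is the two-point numerical entropy flux $$\hat f^S_{(j,k)}=\{\!\{\mathbf w\}\!\}_{(j,k)}^T\hat{\mathbf f}^{\mathrm{EC}}_{(j,k)}+\tfrac12\mathbf w_j^T\mathbf\Phi^{\diamond,\mathrm{EC}}_{(j,k)}+\tfrac12\mathbf w_k^T\mathbf\Phi^{\diamond,\mathrm{EC}}_{(k,j)}-\{\!\{\Psi\}\!\}_{(j,k)} .$$ (b) (Entropy dissipation at interfaces) For any symmetric positive definite matrix $\mathcal H$ and any $\lambda\ge0$, the surface flux $\hat{\mathbf f}_{(L,R)}=\hat{\mathbf f}^{\mathrm{EC}}_{(L,R)}-\frac12\lambda\,\mathcal H\,[\![\mathbf w]\!]_{(L,R)}$ together with the surface non-conservative term $\mathbf\Phi^\diamond_{(L,R)}=\mathbf\Phi^{\diamond,\mathrm{EC}}_{(L,R)}$ is entropy dissipative: for all admissible states $\mathbf u_L,\mathbf u_R$,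 the entropy production satisfies $$r_{(L,R)}=[\![\mathbf w]\!]_{(L,R)}^T\hat{\mathbf f}_{(L,R)}+\mathbf w_R^T\mathbf\Phi^\diamond_{(R,L)}-\mathbf w_L^T\mathbf\Phi^\diamond_{(L,R)}-[\![\Psi]\!]_{(L,R)}\le0 .$$
   Context: **State.** $N_i\ge1$ ion species with constants $\gamma_k>1$, $r_k$; $c_h$ a constant. State $\mathbf u=(\rho_k,\rho_k\vec v_k,E_k,\vec B,\psi)$, meaning the $5N_i$ quantities $\rho_k\in\mathbb R$, $\rho_k\vec v_k\in\mathbb R^3$, $E_k\in\mathbb R$ for $k=1,\dots,N_i$ together with $\vec B=(B_1,B_2,B_3)$ and $\psi\in\mathbb R$. Here $E_k=\frac12\rho_k\|\vec v_k\|^2+\frac{p_k}{\gamma_k-1}+\frac12\|\vec B\|^2+\frac12\psi^2$; admissible means $\rho_k,p_k>0$ for all $k$ (all nodal and outer states are admissible). Define $n_ee=\sum_kr_k\rho_k$ (assumed nonzero), $\vec v^+_k=\frac{r_k\rho_k\vec v_k}{n_ee}$, $\vec v^+=\sum_k\vec v^+_k$, $\vec v^-_k=\vec v^+-\vec v^+_k$, $\beta_k=\frac{\rho_k}{2p_k}$, $\beta_+=\sum_k\beta_k$; $p_e$ (electron pressure) is a given function of the state. Vectors below list the components $(\rho_k;\rho_kv_{k,1};\rho_kv_{k,2};\rho_kv_{k,3};E_k;B_1;B_2;B_3;\psi)$, the first five for every $k$. **Entropy.** $s_k=\ln p_k-\gamma_k\ln\rho_k$, $S=\sum_k\frac{-\rho_ks_k}{\gamma_k-1}$,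 entropy variables $\mathbf w=\partial S/\partial\mathbf u=\big(\frac{\gamma_k-s_k}{\gamma_k-1}-\beta_k\|\vec v_k\|^2;\,2\beta_kv_{k,1};\,2\beta_kv_{k,2};\,2\beta_kv_{k,3};\,-2\beta_k;\,2\beta_+B_1;\,2\beta_+B_2;\,2\beta_+B_3;\,2\beta_+\psi\big)^T$, entropy flux $f^S=\sum_kv_{k,1}\frac{-\rho_ks_k}{\gamma_k-1}$. **Continuous flux in the $x$-direction.** $\mathbf f$ has components $\rho_k$: $\rho_kv_{k,1}$; $\rho_kv_{k,1}$: $\rho_kv_{k,1}^2+p_k$; $\rho_kv_{k,2}$: $\rho_kv_{k,1}v_{k,2}$; $\rho_kv_{k,3}$: $\rho_kv_{k,1}v_{k,3}$; $E_k$: $v_{k,1}\big(\frac12\rho_k\|\vec v_k\|^2+\frac{\gamma_kp_k}{\gamma_k-1}\big)+v^+_{k,1}\|\vec B\|^2-B_1(\vec v^+_k\cdot\vec B)+c_h\psi B_1$; $B_1$: $c_h\psi$; $B_2$: $v^+_1B_2-v^+_2B_1$; $B_3$: $v^+_1B_3-v^+_3B_1$; $\psi$: $c_hB_1$. **Non-derivative version of the non-conservative terms.** $\mathbf\Phi=\boldsymbol\phi^{\mathrm{GP}}B_1+\boldsymbol\phi^{\mathrm{Lor}}\circ\mathbf h^{\mathrm{Lor}}+\mathbf\Phi^{\mathrm{multi}}+\boldsymbol\phi^{\mathrm{GLM}}\psi$, where $\circ$ is the componentwise product and - $\boldsymbol\phi^{\mathrm{GP}}=\big(0;\frac{r_k\rho_k}{n_ee}B_1;\frac{r_k\rho_k}{n_ee}B_2;\frac{r_k\rho_k}{n_ee}B_3;\vec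 v^+\cdot\vec B;v^+_1;v^+_2;v^+_3;0\big)^T$; - $\boldsymbol\phi^{\mathrm{Lor}}=\big(0;\frac{r_k\rho_k}{n_ee};\frac{r_k\rho_k}{n_ee};\frac{r_k\rho_k}{n_ee};v^+_{k,1};0;0;0;0\big)^T$, $\mathbf h^{\mathrm{Lor}}=\big(0;\frac12\|\vec B\|^2-B_1^2+p_e;-B_1B_2;-B_1B_3;p_e;0;0;0;0\big)^T$; - $\mathbf\Phi^{\mathrm{multi}}$ has only $E_k$-components nonzero, equal to $B_2(v^-_{k,1}B_2-v^-_{k,2}B_1)+B_3(v^-_{k,1}B_3-v^-_{k,3}B_1)$; - $\boldsymbol\phi^{\mathrm{GLM}}$ has $E_k$-components $v^+_1\psi$, $\psi$-component $v^+_1$, and zeros elsewhere. **Entropy potential.** $\Psi=\mathbf w^T(\mathbf f+\mathbf\Phi)-f^S$. **Averages.** For states $\mathbf u_i,\mathbf u_j$ and a quantity $a$: $[\![a]\!]_{(i,j)}=a_j-a_i$, $\{\!\{a\}\!\}=\frac12(a_i+a_j)$, $a^{\ln}=[\![a]\!]/[\![\ln a]\!]$ (and $a^{\ln}=a_i$ if $a_i=a_j$). $\bar p_e$ is any symmetric two-point average of $p_e$ that equals $p_e(\mathbf u_i)$ for $\mathbf u_i=\mathbf u_j$. $\overline p_k=\frac{\{\!\{\rho_k\}\!\}}{2\{\!\{\beta_k\}\!\}}$. **Numerical flux** $\hat{\mathbf f}^{\mathrm{EC}}_{(i,j)}$, componentwise: $\rho_k$: $\hat f_{\rho_k}=\rho_k^{\ln}\{\!\{v_{k,1}\}\!\}$;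 $\rho_kv_{k,1}$: $\hat f_{\rho_kv_{k,1}}=\rho_k^{\ln}\{\!\{v_{k,1}\}\!\}^2+\overline p_k$; $\rho_kv_{k,2}$: $\hat f_{\rho_kv_{k,2}}=\rho_k^{\ln}\{\!\{v_{k,1}\}\!\}\{\!\{v_{k,2}\}\!\}$; $\rho_kv_{k,3}$: $\hat f_{\rho_kv_{k,3}}=\rho_k^{\ln}\{\!\{v_{k,1}\}\!\}\{\!\{v_{k,3}\}\!\}$; $E_k$: $\hat f^{\mathrm{Euler}}_{E_k}+\hat f^{\mathrm{mMHD}}_{E_k}+2c_h\{\!\{\psi\}\!\}\{\!\{B_1\}\!\}-c_h\{\!\{\psi B_1\}\!\}$; $B_1$: $c_h\{\!\{\psi\}\!\}$; $B_2$: $\{\!\{v^+_1\}\!\}\{\!\{B_2\}\!\}-\{\!\{v^+_2\}\!\}\{\!\{B_1\}\!\}$; $B_3$: $\{\!\{v^+_1\}\!\}\{\!\{B_3\}\!\}-\{\!\{v^+_3\}\!\}\{\!\{B_1\}\!\}$; $\psi$: $c_h\{\!\{B_1\}\!\}$. Here $$\hat f^{\mathrm{Euler}}_{E_k}=\hat f_{\rho_k}\Big[\frac{1}{2(\gamma_k-1)\beta_k^{\ln}}-\frac12\{\!\{\|\vec v_k\|^2\}\!\}\Big]+\sum_{m=1}^3\hat f_{\rho_kv_{k,m}}\{\!\{v_{k,m}\}\!\},$$ $$\hat f^{\mathrm{mMHD}}_{E_k}=\{\!\{\vec B\}\!\}\cdot\hat{\vec f}^{\,\mathrm{mMHD}}_{\vec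 B}-\tfrac12\{\!\{v^+_{k,1}\|\vec B\|^2\}\!\}+\{\!\{\vec v^+_k\cdot\vec B\}\!\}\{\!\{B_1\}\!\}+\tfrac12\{\!\{v^+_{k,1}\}\!\}\{\!\{\|\vec B\|^2\}\!\}-\{\!\{\vec v^+_k\}\!\}\cdot\{\!\{\vec B\}\!\}\{\!\{B_1\}\!\}-\{\!\{\vec B\}\!\}\cdot\vec h_k,$$ $$\hat{\vec f}^{\,\mathrm{mMHD}}_{\vec B}=\big(0,\ \{\!\{v^+_1\}\!\}\{\!\{B_2\}\!\}-\{\!\{v^+_2\}\!\}\{\!\{B_1\}\!\},\ \{\!\{v^+_1\}\!\}\{\!\{B_3\}\!\}-\{\!\{v^+_3\}\!\}\{\!\{B_1\}\!\}\big)^T,\qquad \vec h_k=\{\!\{\vec B\}\!\}\{\!\{v^-_{k,1}\}\!\}-\{\!\{\vec v^-_k\}\!\}\{\!\{B_1\}\!\}.$$ **Numerical non-conservative term** $\mathbf\Phi^{\diamond,\mathrm{EC}}_{(i,j)}$ is the sum of: $\boldsymbol\phi^{\mathrm{GP}}(\mathbf u_i)\{\!\{B_1\}\!\}$; $\boldsymbol\phi^{\mathrm{Lor}}(\mathbf u_i)\circ\big(0;\frac12\{\!\{\|\vec B\|^2\}\!\}-\{\!\{B_1\}\!\}^2+\bar p_e;-\{\!\{B_1\}\!\}\{\!\{B_2\}\!\};-\{\!\{B_1\}\!\}\{\!\{B_3\}\!\};\bar p_e;0;0;0;0\big)^T$; the vector whose only nonzero components are the $E_k$-components $\vec B_i\cdot\vec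 h_k$; and $\boldsymbol\phi^{\mathrm{GLM}}(\mathbf u_i)\{\!\{\psi\}\!\}$. (All averages are between $\mathbf u_i$ and $\mathbf u_j$.) **DG scheme on one element.** Let $N\ge1$, $\xi_0<\dots<\xi_N$ the Legendre–Gauss–Lobatto nodes on $[-1,1]$ with quadrature weights $\omega_j$, $\ell_k$ the Lagrange polynomials on these nodes, $Q_{jk}=\omega_j\ell_k'(\xi_j)$, $\mathcal B=\mathrm{diag}(-1,0,\dots,0,1)\in\mathbb R^{(N+1)\times(N+1)}$, and $\mathbf S=2Q-\mathcal B$ with entries $S_{jk}$. With constant Jacobian $J>0$, nodal states $\mathbf u_0,\dots,\mathbf u_N$ and outer states $\mathbf u_L$ (left) and $\mathbf u_R$ (right), the semi-discrete scheme is, for $j=0,\dots,N$, $$J\omega_j\dot{\mathbf u}_j+\sum_{k=0}^NS_{jk}\big(\mathbf f^*_{(j,k)}+\mathbf\Phi^\star_{(j,k)}\big)-\delta_{j0}\big(\hat{\mathbf f}_{(0,L)}+\mathbf\Phi^\diamond_{(0,L)}\big)+\delta_{jN}\big(\hat{\mathbf f}_{(N,R)}+\mathbf\Phi^\diamond_{(N,R)}\big)=\mathbf 0,$$ where $\mathbf f^*,\mathbf\Phi^\star$ (volume) and $\hat{\mathbf f},\mathbf\Phi^\diamond$ (surface) are two-point fluxes and non-conservative terms; a subscript $(a,b)$ means evaluation at $(\mathbf u_a,\mathbf u_b)$. *)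

(* Defs.v *)
From HB Require Import structures.
From mathcomp Require Import all_boot all_order all_algebra.
From mathcomp Require Import all_classical all_reals all_analysis.
From mathcomp Require Import ring.

Set Implicit Arguments.
Unset Strict Implicit.
Unset Printing Implicit Defensive.

Import Order.TTheory GRing.Theory Num.Theory.
Import numFieldNormedType.Exports.
Local Open Scope classical_set_scope.
Local Open Scope ring_scope.

(* Spatial directions 1, 2, 3; a vector of R^3 is a function 'I_3 -> R. *)
Definition x1 : 'I_3 := @Ordinal 3 0 isT.
Definition x2 : 'I_3 := @Ordinal 3 1 isT.
Definition x3 : 'I_3 := @Ordinal 3 2 isT.

(* The 5 components (rho_k, rho_k v_k, E_k) of each of the Ni species, stored
   species by species, followed by (B_1, B_2, B_3, psi). *)
Notation state R Ni := 'cV[R]_(Ni * 5 + 4).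

Section LinearAlgebra.
Context {R : realType}.

Definition dotp n (a b : 'cV[R]_n) : R := (a^T *m b) 0 0.

Definition hadamard n (a b : 'cV[R]_n) : 'cV[R]_n := map2_mx *%R a b.

Definition sym_posdef n (H : 'M[R]_n) : Prop :=
  H^T = H /\ forall x : 'cV[R]_n, x != 0 -> 0 < dotp x (H *m x).

Definition vec Ni (a m1 m2 m3 e : 'I_Ni -> R) (b1 b2 b3 c : R) : state R Ni :=
  (row_mx (mxvec (\matrix_(k < Ni, i < 5) [:: a k; m1 k; m2 k; m3 k; e k]`_i))
          (\row_(i < 4) [:: b1; b2; b3; c]`_i))^T.

Definition ion_comp Ni (u : state R Ni) (k : 'I_Ni) (i : 'I_5) : R :=
  u (lshift 4 (mxvec_index k i)) 0.

Definition field_comp Ni (u : state R Ni) (i : 'I_4) : R :=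
  u (rshift (Ni * 5) i) 0.

End LinearAlgebra.

Section Averages.
Context {R : realType} {Ni : nat}.
Implicit Types ui uj : state R Ni.

Definition jump (V : zmodType) (q : state R Ni -> V) ui uj : V := q uj - q ui.

Definition avg (q : state R Ni -> R) ui uj : R := (q ui + q uj) / 2.

Definition avgv n (q : state R Ni -> 'cV[R]_n) ui uj : 'cV[R]_n :=
  2^-1 *: (q ui + q uj).

Definition lnavg (q : state R Ni -> R) ui uj : R :=
  if q ui == q uj then q ui
  else jump q ui uj / jump (fun u => ln (q u)) ui uj.

(* Symmetry and consistency are only required on the physically relevant
   states D. *)
Definition symmetric_average (D : state R Ni -> Prop)
    (q : state R Ni -> R) (qbar : state R Ni -> state R Ni -> R) : Prop :=
  (forall ui uj, D ui -> D uj -> qbar ui uj = qbar uj ui) /\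
  (forall u, D u -> qbar u u = q u).

End Averages.

Section MultiIonMHD.
Context {R : realType} {Ni : nat}.
Variables (gam r : 'I_Ni -> R) (ch : R).
Variables (pe : state R Ni -> R) (pebar : state R Ni -> state R Ni -> R).
Implicit Types (k : 'I_Ni) (m : 'I_3) (u : state R Ni).

Definition rho k u : R := ion_comp u k (@Ordinal 5 0 isT).
Definition mom k m u : R :=
  ion_comp u k (lift ord0 (widen_ord (isT : 3 <= 4)%N m)).
Definition ener k u : R := ion_comp u k (@Ordinal 5 4 isT).
Definition mag m u : R := field_comp u (widen_ord (isT : 3 <= 4)%N m).
Definition psi u : R := field_comp u (@Ordinal 4 3 isT).

Definition vel k m u : R := mom k m u / rho k u.
Definition velsq k u : R := \sum_m vel k m u ^+ 2.
Definition magsq u : R := \sum_m mag m u ^+ 2.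

(* Solves E_k = rho_k|v_k|^2/2 + p_k/(gamma_k - 1) + |B|^2/2 + psi^2/2. *)
Definition pres k u : R :=
  (gam k - 1) *
  (ener k u - rho k u * velsq k u / 2 - magsq u / 2 - psi u ^+ 2 / 2).

Definition nee u : R := \sum_k r k * rho k u.

(* The standing assumption n_e e <> 0 is included. *)
Definition admissible u : Prop :=
  (forall k, 0 < rho k u /\ 0 < pres k u) /\ nee u != 0.

Definition vplusk k m u : R := r k * rho k u * vel k m u / nee u.
Definition vplus m u : R := \sum_k vplusk k m u.
Definition vminusk k m u : R := vplus m u - vplusk k m u.
Definition vplusk_mag k u : R := \sum_m vplusk k m u * mag m u.
Definition vplus_mag u : R := \sum_m vplus m u * mag m u.

Definition beta k u : R := rho k u / (2 * pres k u).
Definition beta_plus u : R := \sum_k beta k u.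

Definition sk k u : R := ln (pres k u) - gam k * ln (rho k u).
Definition entropy u : R := \sum_k - (rho k u * sk k u) / (gam k - 1).
Definition entropy_flux u : R :=
  \sum_k vel k x1 u * (- (rho k u * sk k u) / (gam k - 1)).

(* The gradient of the entropy with respect to the conserved variables; see
   entropy_varsE below for the closed form. *)
Definition entropy_vars u : state R Ni :=
  \col_i 'D_(delta_mx i 0) entropy u.

Definition flux u : state R Ni :=
  vec (fun k => rho k u * vel k x1 u)
      (fun k => rho k u * vel k x1 u ^+ 2 + pres k u)
      (fun k => rho k u * vel k x1 u * vel k x2 u)
      (fun k => rho k u * vel k x1 u * vel k x3 u)
      (fun k => vel k x1 u * (rho k u * velsq k u / 2
                              + gam k * pres k u / (gam k - 1))
                + vplusk k x1 u * magsq u - mag x1 u * vplusk_mag k u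
                + ch * psi u * mag x1 u)
      (ch * psi u)
      (vplus x1 u * mag x2 u - vplus x2 u * mag x1 u)
      (vplus x1 u * mag x3 u - vplus x3 u * mag x1 u)
      (ch * mag x1 u).

Definition phiGP u : state R Ni :=
  vec (fun=> 0)
      (fun k => r k * rho k u / nee u * mag x1 u)
      (fun k => r k * rho k u / nee u * mag x2 u)
      (fun k => r k * rho k u / nee u * mag x3 u)
      (fun=> vplus_mag u)
      (vplus x1 u) (vplus x2 u) (vplus x3 u) 0.

Definition phiLor u : state R Ni :=
  vec (fun=> 0)
      (fun k => r k * rho k u / nee u)
      (fun k => r k * rho k u / nee u)
      (fun k => r k * rho k u / nee u)
      (fun k => vplusk k x1 u)
      0 0 0 0.

Definition hLor u : state R Ni :=
  vec (fun=> 0)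
      (fun=> magsq u / 2 - mag x1 u ^+ 2 + pe u)
      (fun=> - (mag x1 u * mag x2 u))
      (fun=> - (mag x1 u * mag x3 u))
      (fun=> pe u)
      0 0 0 0.

Definition Phimulti u : state R Ni :=
  vec (fun=> 0) (fun=> 0) (fun=> 0) (fun=> 0)
      (fun k => mag x2 u * (vminusk k x1 u * mag x2 u - vminusk k x2 u * mag x1 u)
              + mag x3 u * (vminusk k x1 u * mag x3 u - vminusk k x3 u * mag x1 u))
      0 0 0 0.

Definition phiGLM u : state R Ni :=
  vec (fun=> 0) (fun=> 0) (fun=> 0) (fun=> 0)
      (fun=> vplus x1 u * psi u)
      0 0 0 (vplus x1 u).

Definition Phi u : state R Ni :=
  mag x1 u *: phiGP u + hadamard (phiLor u) (hLor u) + Phimulti u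
  + psi u *: phiGLM u.

Definition entropy_potential u : R :=
  dotp (entropy_vars u) (flux u + Phi u) - entropy_flux u.

Section TwoPoint.
Variables (ui uj : state R Ni).
Local Notation mean q := (avg q ui uj).
Local Notation lnmean q := (lnavg q ui uj).

Definition pbar k : R := mean (rho k) / (2 * mean (beta k)).

Definition f_rho k : R := lnmean (rho k) * mean (vel k x1).

Definition f_mom k m : R :=
  lnmean (rho k) * mean (vel k x1) * mean (vel k m)
  + (if m == x1 then pbar k else 0).

Definition f_Euler k : R :=
  f_rho k * ((2 * (gam k - 1) * lnmean (beta k))^-1 - mean (velsq k) / 2)
  + \sum_m f_mom k m * mean (vel k m).

(* Its first component is 0, as required. *)
Definition f_mag m : R :=
  mean (vplus x1) * mean (mag m) - mean (vplus m) * mean (mag x1).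

Definition hk k m : R :=
  mean (mag m) * mean (vminusk k x1) - mean (vminusk k m) * mean (mag x1).

Definition f_mMHD k : R :=
  \sum_m mean (mag m) * f_mag m
  - mean (fun u => vplusk k x1 u * magsq u) / 2
  + mean (vplusk_mag k) * mean (mag x1)
  + mean (vplusk k x1) * mean magsq / 2
  - (\sum_m mean (vplusk k m) * mean (mag m)) * mean (mag x1)
  - \sum_m mean (mag m) * hk k m.

Definition fluxEC : state R Ni :=
  vec f_rho (f_mom^~ x1) (f_mom^~ x2) (f_mom^~ x3)
      (fun k => f_Euler k + f_mMHD k + 2 * ch * mean psi * mean (mag x1)
                - ch * mean (fun u => psi u * mag x1 u))
      (ch * mean psi) (f_mag x2) (f_mag x3) (ch * mean (mag x1)).

Definition hLorEC : state R Ni :=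
  vec (fun=> 0)
      (fun=> mean magsq / 2 - mean (mag x1) ^+ 2 + pebar ui uj)
      (fun=> - (mean (mag x1) * mean (mag x2)))
      (fun=> - (mean (mag x1) * mean (mag x3)))
      (fun=> pebar ui uj)
      0 0 0 0.

Definition PhimultiEC : state R Ni :=
  vec (fun=> 0) (fun=> 0) (fun=> 0) (fun=> 0)
      (fun k => \sum_m mag m ui * hk k m)
      0 0 0 0.

Definition PhiEC : state R Ni :=
  mean (mag x1) *: phiGP ui + hadamard (phiLor ui) hLorEC + PhimultiEC
  + mean psi *: phiGLM ui.

End TwoPoint.

Definition entropy_flux_EC ui uj : R :=
  dotp (avgv entropy_vars ui uj) (fluxEC ui uj)
  + dotp (entropy_vars ui) (PhiEC ui uj) / 2
  + dotp (entropy_vars uj) (PhiEC uj ui) / 2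
  - avg entropy_potential ui uj.

(* Entropy production of an arbitrary two-point flux fh and two-point
   non-conservative term Ph. *)
Definition entropy_production
    (fh Ph : state R Ni -> state R Ni -> state R Ni) uL uR : R :=
  dotp (jump entropy_vars uL uR) (fh uL uR)
  + dotp (entropy_vars uR) (Ph uR uL)
  - dotp (entropy_vars uL) (Ph uL uR)
  - jump entropy_potential uL uR.

Definition fluxES (H : 'M[R]_(Ni * 5 + 4)) (lam : R) uL uR : state R Ni :=
  fluxEC uL uR - (lam / 2) *: (H *m jump entropy_vars uL uR).

End MultiIonMHD.

Section EntropyGradient.
Context {R : realType}.

(* A non-class copy of is_derive _ 1, to keep instance resolution from firing. *)
Local Definition der (f : R -> R) (x df : R) : Prop := is_derive x 1 f df.

Let der_cst (c x : R) : der (fun=> c) x 0.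
Proof. exact: is_derive_cst. Qed.

Let derM (f g : R -> R) (x df dg : R) : der f x df -> der g x dg ->
  der (fun t => f t * g t) x (f x * dg + g x * df).
Proof. by move=> ? ?; exact: (@is_deriveM _ _ f g). Qed.

Let derD (f g : R -> R) (x df dg : R) : der f x df -> der g x dg ->
  der (fun t => f t + g t) x (df + dg).
Proof. by move=> ? ?; exact: (@is_deriveD _ _ _ f g). Qed.

Let derN (f : R -> R) (x df : R) : der f x df -> der (fun t => - f t) x (- df).
Proof. by move=> ?; exact: (@is_deriveN _ _ _ f). Qed.

Let derX (f : R -> R) (x df : R) :
  der f x df -> der (fun t => f t ^+ 2) x (2 * f x * df).
Proof. by move=> ?; exact: (@is_deriveX _ _ f 2). Qed.

Let derV (f : R -> R) (x df : R) : f x != 0 ->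
  der f x df -> der (fun t => (f t)^-1) x (- (f x) ^- 2 * df).
Proof. by move=> ? ?; exact: is_deriveV. Qed.

Let derln (f : R -> R) (x df : R) : 0 < f x ->
  der f x df -> der (fun t => ln (f t)) x ((f x)^-1 * df).
Proof.
move=> fx0 dfx.
exact: (@is_derive1_comp R (@ln R) f x _ _ (is_derive1_ln fx0) dfx).
Qed.

Let der_sum n (f : 'I_n -> R -> R) (x : R) (df : 'I_n -> R) :
  (forall i, der (f i) x (df i)) ->
  der (fun t => \sum_i f i t) x (\sum_i df i).
Proof.
move=> dfx; have -> : (fun t => \sum_i f i t) = \sum_i f i.
  by apply/funext => t; rewrite fct_sumE.
exact: is_derive_sum.
Qed.

Let der_eq (f : R -> R) (x df df' : R) : der f x df' -> df' = df -> der f x df.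
Proof. by move=> ? <-. Qed.

Let der_affine (a b x : R) : der (fun t => t * a + b) x a.
Proof.
apply: der_eq.
  apply: derD; last exact: der_cst.
  by apply: derM; [exact: is_derive_id|exact: der_cst].
by rewrite /= mulr0 mulr1 add0r addr0.
Qed.

Let sum3 (F : 'I_3 -> R) : \sum_m F m = F x1 + F x2 + F x3.
Proof.
rewrite !big_ord_recl big_ord0 addr0 addrA.
by congr (F _ + F _ + F _); apply/val_inj.
Qed.

Variable Ni : nat.
Implicit Types (u d : state R Ni) (k : 'I_Ni) (m : 'I_3) (t : R).

Lemma dotp_vecl (a m1 m2 m3 e : 'I_Ni -> R) (b1 b2 b3 c : R) d :
  dotp (vec a m1 m2 m3 e b1 b2 b3 c) d =
  \sum_k (a k * rho k d + m1 k * mom k x1 d + m2 k * mom k x2 d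
          + m3 k * mom k x3 d + e k * ener k d)
  + (b1 * mag x1 d + b2 * mag x2 d + b3 * mag x3 d + c * psi d).
Proof.
rewrite /dotp mxE /vec trmxK big_split_ord /=; congr (_ + _).
  rewrite (reindex _ (curry_mxvec_bij _ _)) /=.
  transitivity (\sum_k \sum_j (row_mx (mxvec (\matrix_(k, i)
      [:: a k; m1 k; m2 k; m3 k; e k]`_i)) (\row_i [:: b1; b2; b3; c]`_i))
      0 (lshift 4 (mxvec_index k j)) * d (lshift 4 (mxvec_index k j)) 0).
    by rewrite pair_bigA; apply: eq_bigr => -[].
  apply: eq_bigr => k _.
  under eq_bigr do rewrite row_mxEl mxvecE mxE.
  rewrite !big_ord_recl big_ord0 /= addr0 !addrA.
  by rewrite /rho /mom /ener /ion_comp; do 4! (congr (_ + _); last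
    by congr (_ * d (lshift _ (mxvec_index _ _)) _); apply/val_inj);
    congr (_ * d (lshift _ (mxvec_index _ _)) _); apply/val_inj.
under eq_bigr do rewrite row_mxEr mxE.
rewrite !big_ord_recl big_ord0 /= addr0 !addrA.
by rewrite /mag /psi /field_comp; do 3! (congr (_ + _); last
  by congr (_ * d (rshift _ _) _); apply/val_inj);
  congr (_ * d (rshift _ _) _); apply/val_inj.
Qed.

Variables (gam r : 'I_Ni -> R).

Lemma entropy_varsE u : (forall k, 1 < gam k) -> admissible gam r u ->
  entropy_vars gam u =
  vec (fun k => (gam k - sk gam k u) / (gam k - 1) - beta gam k u * velsq k u)
      (fun k => 2 * beta gam k u * vel k x1 u)
      (fun k => 2 * beta gam k u * vel k x2 u)
      (fun k => 2 * beta gam k u * vel k x3 u)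
      (fun k => - (2 * beta gam k u))
      (2 * beta_plus gam u * mag x1 u)
      (2 * beta_plus gam u * mag x2 u)
      (2 * beta_plus gam u * mag x3 u)
      (2 * beta_plus gam u * psi u).
Proof.
move=> gam1 [pos _].
have dotp_delta (a : state R Ni) i : dotp a (delta_mx i 0) = a i 0.
  rewrite /dotp mxE (bigD1 i) //= big1 => [|j /negbTE ji]; last first.
    by rewrite !mxE ji mulr0.
  by rewrite !mxE !eqxx mulr1 addr0.
have sec_rho k d t : rho k (t *: d + u) = t * rho k d + rho k u.
  by rewrite /rho /ion_comp !mxE.
have sec_mom k m d t : mom k m (t *: d + u) = t * mom k m d + mom k m u.
  by rewrite /mom /ion_comp !mxE.
have sec_ener k d t : ener k (t *: d + u) = t * ener k d + ener k u.
  by rewrite /ener /ion_comp !mxE.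
have sec_mag m d t : mag m (t *: d + u) = t * mag m d + mag m u.
  by rewrite /mag /field_comp !mxE.
have sec_psi d t : psi (t *: d + u) = t * psi d + psi u.
  by rewrite /psi /field_comp !mxE.
have drho k d : der (fun t => rho k (t *: d + u)) 0 (rho k d).
  by under eq_fun do rewrite sec_rho; exact: der_affine.
have dmom k m d : der (fun t => mom k m (t *: d + u)) 0 (mom k m d).
  by under eq_fun do rewrite sec_mom; exact: der_affine.
have dener k d : der (fun t => ener k (t *: d + u)) 0 (ener k d).
  by under eq_fun do rewrite sec_ener; exact: der_affine.
have dmag m d : der (fun t => mag m (t *: d + u)) 0 (mag m d).
  by under eq_fun do rewrite sec_mag; exact: der_affine.
have dpsi d : der (fun t => psi (t *: d + u)) 0 (psi d).
  by under eq_fun do rewrite sec_psi; exact: der_affine.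
have at0 d : 0 *: d + u = u by rewrite scale0r add0r.
apply/matrixP => i j; rewrite {j}ord1 mxE.
set W := vec _ _ _ _ _ _ _ _ _; rewrite -(dotp_delta W i).
move: (delta_mx i 0) => d {i dotp_delta}.
have -> : 'D_d (entropy gam) u
    = 'D_1 (fun t : R => entropy gam (t *: d + u)) 0.
  rewrite /derive; apply: (congr1 (fun g : R -> R => lim (g @ 0^'))).
  apply/funext => h /=.
  by rewrite addr0 scale0r add0r [_%:A]mulr1.
rewrite /entropy.
have dpres k : der (fun t => pres gam k (t *: d + u)) 0
   ((gam k - 1) * (ener k d + velsq k u / 2 * rho k d
      - \sum_m vel k m u * mom k m d - \sum_m mag m u * mag m d
      - psi u * psi d)).
  rewrite /pres /velsq /magsq /vel.
  apply: der_eq.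
    apply: derM; first exact: der_cst.
    apply: derD; last first.
      by apply: derN; apply: derM; [apply: derX|exact: der_cst].
    apply: derD; last first.
      apply: derN; apply: derM; last exact: der_cst.
      by apply: der_sum => m; apply: derX.
    apply: derD => //.
    apply: derN; apply: derM; last exact: der_cst.
    apply: derM => //; apply: der_sum => m; apply: derX; apply: derM => //.
    by apply: derV => //; rewrite at0 gt_eqF//; have [] := pos k.
  have := (pos k).1 => /lt0r_neq0 rk0.
  rewrite at0 !sum3 /=; field.
  by rewrite rk0.
have dent k :
  der (fun t => - (rho k (t *: d + u) * sk gam k (t *: d + u)) / (gam k - 1)) 0
    (((gam k - sk gam k u) / (gam k - 1) - beta gam k u * velsq k u) * rho k d
     + 2 * beta gam k u * \sum_m vel k m u * mom k m d
     - 2 * beta gam k u * ener k d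
     + 2 * beta gam k u * (\sum_m mag m u * mag m d + psi u * psi d)).
  have [rk0 pk0] := pos k.
  rewrite /sk; apply: der_eq.
    apply: derM; last exact: der_cst.
    apply: derN; apply: derM => //.
    apply: derD; first by apply: derln; rewrite ?at0.
    apply: derN; apply: derM; first exact: der_cst.
    by apply: derln; rewrite ?at0.
  rewrite /= !at0 /beta; field.
  by rewrite subr_eq0 !gt_eqF ?gam1.
rewrite (derive_val (is_derive := der_sum dent)) /W dotp_vecl.
rewrite /beta_plus.
rewrite [2 * _]mulr_sumr.
rewrite -!mulrA !mulr_suml -!big_split /=.
apply: eq_bigr => k _; rewrite !sum3; ring.
Qed.

End EntropyGradient.
Section LGL.
Context {R : realType} {N : nat}.
Implicit Types xi : 'I_N.+1 -> R.

(* Rodrigues' formula. *)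
Definition legendre (n : nat) : {poly R} :=
  (2 ^+ n * n`!%:R)^-1 *: (('X^2 - 1) ^+ n)^`(n).

(* (1 - X^2) P_N' has degree N + 1, so the xi_j are all of its roots. *)
Definition lgl_nodes xi : Prop :=
  (forall i j : 'I_N.+1, (i < j)%N -> xi i < xi j) /\
  (forall j, root ((1 - 'X^2) * (legendre N)^`()) (xi j)).

Definition lagrange_poly xi (k : 'I_N.+1) : {poly R} :=
  \prod_(m < N.+1 | m != k) ((xi k - xi m)^-1 *: ('X - (xi m)%:P)).

Definition lgl_weight xi (j : 'I_N.+1) : R :=
  \int[lebesgue_measure]_(x in `[-1, 1]) (lagrange_poly xi j).[x].

Definition Qmx xi : 'M[R]_N.+1 :=
  \matrix_(j, k) (lgl_weight xi j * (lagrange_poly xi k)^`().[xi j]).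

Definition Bmx : 'M[R]_N.+1 :=
  diag_mx (\row_j ((j == ord_max)%:R - (j == ord0)%:R)).

Definition Smx xi : 'M[R]_N.+1 := 2 *: Qmx xi - Bmx.

Variable Ni : nat.

Definition dg_scheme xi (J : R)
    (fvol Phivol fsurf Phisurf : state R Ni -> state R Ni -> state R Ni)
    (u : 'I_N.+1 -> state R Ni) (uL uR : state R Ni)
    (dotu : 'I_N.+1 -> state R Ni) : Prop :=
  forall j : 'I_N.+1,
    (J * lgl_weight xi j) *: dotu j
    + \sum_k Smx xi j k *: (fvol (u j) (u k) + Phivol (u j) (u k))
    - (j == ord0)%:R *: (fsurf (u ord0) uL + Phisurf (u ord0) uL)
    + (j == ord_max)%:R *: (fsurf (u ord_max) uR + Phisurf (u ord_max) uR)
    = 0.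

End LGL.

(* Main.v *)
Require Import Defs.
From HB Require Import structures.
From mathcomp Require Import all_boot all_order all_algebra.
From mathcomp Require Import all_classical all_reals all_analysis.
From mathcomp Require Import ring lra zify.

Import Order.TTheory GRing.Theory Num.Theory.
Import numFieldNormedType.Exports.
Local Open Scope classical_set_scope.
Local Open Scope ring_scope.

(** Both claims rest on one algebraic identity. For two admissible states, the
    jump of the entropy variables w tested against the two-point flux, plus
    the difference of the non-conservative terms tested against the one-sided
    w, is exactly the jump of the entropy potential Psi
    ([entropy_production_EC]). To prove it, expand beta_+ as the sum of the
    beta_k, so that the contraction of w with any vector is a sum over species
    ([dotp_entropy_vars]). The identity then holds species by species, even
    with the total charge velocity v^+ treated as an unknown unrelated to the
    v^+_k. After the electron pressure has cancelled between momentum and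
    energy, what remains is polynomial in the states and follows from two
    relations: the logarithmic means turn the jump of ln rho_k and ln beta_k
    into jumps of rho_k and beta_k ([entropy_rho_jump]), and the averaged
    pressure satisfies 2 pbar {{beta}} = {{rho}} ([pbarM]).

    Entropy dissipation is immediate from it: the stabilization adds the
    nonpositive quadratic form - lambda/2 [[w]]^T H [[w]].

    For the scheme, test the nodal equations with w_j and sum. The matrix
    S = 2 Q - B is skew-symmetric because Legendre-Gauss-Lobatto quadrature is
    exact up to degree 2 N - 1, which makes Q + Q^T = B a discrete integration
    by parts ([Qmx_sbp]). Hence the volume sum only sees the antisymmetric part
    of w_j . (f + Phi)_(j,k), which by the identity is a difference
    Psi_j - Psi_k; the rows of S sum to those of - B, and the volume sum
    collapses to Psi_0 - Psi_N ([skew_telescope]). These two boundary terms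
    complete the surface terms to the numerical entropy fluxes
    ([surface_entropy_flux]).

    Exactness of the quadrature is the classical argument: the nodal polynomial
    is a multiple of (1 - X^2) P_N' ([nodal_poly_legendre]), and this is
    orthogonal to every polynomial of degree less than N - 1
    ([pint_deriv_legendre]) by Rodrigues' formula and integration by parts.
    That the end nodes are -1 and 1 follows from P_N' having no zero outside
    [-1, 1] ([deriv_legendre_neq0]). *)

(** * Vectors of conserved variables and two-point averages *)

Section Components.
Set Implicit Arguments.
Unset Strict Implicit.
Context {R : realType}.

Lemma dotpDr n (a b c : 'cV[R]_n) : dotp a (b + c) = dotp a b + dotp a c.
Proof. by rewrite /dotp mulmxDr mxE. Qed.

Lemma dotpZr n (a b : 'cV[R]_n) (x : R) : dotp a (x *: b) = x * dotp a b.
Proof. by rewrite /dotp -scalemxAr mxE. Qed.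

Lemma dotpNr n (a b : 'cV[R]_n) : dotp a (- b) = - dotp a b.
Proof. by rewrite /dotp mulmxN mxE. Qed.

Lemma dotp0r n (a : 'cV[R]_n) : dotp a 0 = 0.
Proof. by rewrite /dotp mulmx0 mxE. Qed.

Lemma dotp_sumr n (I : finType) (a : 'cV[R]_n) (F : I -> 'cV[R]_n) :
  dotp a (\sum_i F i) = \sum_i dotp a (F i).
Proof. by rewrite /dotp mulmx_sumr summxE. Qed.

Lemma dotpC n (a b : 'cV[R]_n) : dotp a b = dotp b a.
Proof.
rewrite /dotp !mxE; apply: eq_bigr => i _.
by rewrite !mxE mulrC.
Qed.

Lemma dotpDl n (a b c : 'cV[R]_n) : dotp (a + b) c = dotp a c + dotp b c.
Proof. by rewrite dotpC dotpDr !(dotpC c). Qed.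

Lemma dotpBl n (a b c : 'cV[R]_n) : dotp (a - b) c = dotp a c - dotp b c.
Proof. by rewrite dotpC dotpDr dotpNr !(dotpC c). Qed.

Lemma dotpZl n (a b : 'cV[R]_n) (x : R) : dotp (x *: a) b = x * dotp a b.
Proof. by rewrite dotpC dotpZr dotpC. Qed.

Lemma sum_dir (F : 'I_3 -> R) : \sum_m F m = F x1 + F x2 + F x3.
Proof.
rewrite !big_ord_recl big_ord0 addr0 addrA.
by congr (F _ + F _ + F _); apply/val_inj.
Qed.

Context {Ni : nat}.

Lemma stateP (u v : state R Ni) :
  (forall k i, ion_comp u k i = ion_comp v k i) ->
  (forall i, field_comp u i = field_comp v i) -> u = v.
Proof.
move=> ion field; apply/matrixP => i j; rewrite {j}ord1.
case: (split_ordP i) => [l ->|l ->]; last exact: field.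
by case/mxvec_indexP: l => k l; exact: ion.
Qed.

Lemma ion_comp_vec (a m1 m2 m3 e : 'I_Ni -> R) (b1 b2 b3 c : R) k i :
  ion_comp (vec a m1 m2 m3 e b1 b2 b3 c) k i =
  [:: a k; m1 k; m2 k; m3 k; e k]`_i.
Proof. by rewrite /ion_comp /vec mxE row_mxEl mxvecE mxE. Qed.

Lemma field_comp_vec (a m1 m2 m3 e : 'I_Ni -> R) (b1 b2 b3 c : R) i :
  field_comp (vec a m1 m2 m3 e b1 b2 b3 c) i = [:: b1; b2; b3; c]`_i.
Proof. by rewrite /field_comp /vec mxE row_mxEr mxE. Qed.

Lemma vecD (a m1 m2 m3 e a' m1' m2' m3' e' : 'I_Ni -> R)
    (b1 b2 b3 c b1' b2' b3' c' : R) :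
  vec a m1 m2 m3 e b1 b2 b3 c + vec a' m1' m2' m3' e' b1' b2' b3' c' =
  vec (fun k => a k + a' k) (fun k => m1 k + m1' k) (fun k => m2 k + m2' k)
      (fun k => m3 k + m3' k) (fun k => e k + e' k)
      (b1 + b1') (b2 + b2') (b3 + b3') (c + c').
Proof.
apply: stateP => [k i|i].
  rewrite {1}/ion_comp mxE -!/(ion_comp _ _ _) !ion_comp_vec.
  by case: i => -[|[|[|[|[|]]]]].
rewrite {1}/field_comp mxE -!/(field_comp _ _) !field_comp_vec.
by case: i => -[|[|[|[|]]]].
Qed.

Lemma vecZ (x : R) (a m1 m2 m3 e : 'I_Ni -> R) (b1 b2 b3 c : R) :
  x *: vec a m1 m2 m3 e b1 b2 b3 c =
  vec (fun k => x * a k) (fun k => x * m1 k) (fun k => x * m2 k)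
      (fun k => x * m3 k) (fun k => x * e k) (x * b1) (x * b2) (x * b3) (x * c).
Proof.
apply: stateP => [k i|i].
  rewrite {1}/ion_comp mxE -!/(ion_comp _ _ _) !ion_comp_vec.
  by case: i => -[|[|[|[|[|]]]]].
rewrite {1}/field_comp mxE -!/(field_comp _ _) !field_comp_vec.
by case: i => -[|[|[|[|]]]].
Qed.

Lemma hadamard_vec (a m1 m2 m3 e a' m1' m2' m3' e' : 'I_Ni -> R)
    (b1 b2 b3 c b1' b2' b3' c' : R) :
  hadamard (vec a m1 m2 m3 e b1 b2 b3 c) (vec a' m1' m2' m3' e' b1' b2' b3' c') =
  vec (fun k => a k * a' k) (fun k => m1 k * m1' k) (fun k => m2 k * m2' k)
      (fun k => m3 k * m3' k) (fun k => e k * e' k)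
      (b1 * b1') (b2 * b2') (b3 * b3') (c * c').
Proof.
apply: stateP => [k i|i].
  rewrite {1}/ion_comp mxE -!/(ion_comp _ _ _) !ion_comp_vec.
  by case: i => -[|[|[|[|[|]]]]].
rewrite {1}/field_comp mxE -!/(field_comp _ _) !field_comp_vec.
by case: i => -[|[|[|[|]]]].
Qed.

Lemma avgC (q : state R Ni -> R) ui uj : avg q ui uj = avg q uj ui.
Proof. by rewrite /avg addrC. Qed.

Lemma lnavgC (q : state R Ni -> R) ui uj : lnavg q ui uj = lnavg q uj ui.
Proof.
rewrite /lnavg eq_sym; case: (eqVneq (q uj) (q ui)) => [->//|_].
by rewrite /jump -[q uj - _]opprB -[ln (q uj) - _]opprB invrN mulrNN.
Qed.

Lemma subr_ln_neq0 (a b : R) : 0 < a -> 0 < b -> a != b -> ln b - ln a != 0.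
Proof.
move=> a0 b0 ab; rewrite subr_eq0; apply: contra ab => /eqP e.
by apply/eqP/esym/(ln_inj _ _ e); rewrite posrE.
Qed.

(** The branch of [lnavg] for equal arguments keeps this product form valid
    there, both sides being 0. *)
Lemma lnavgM (q : state R Ni -> R) ui uj : 0 < q ui -> 0 < q uj ->
  lnavg q ui uj * (ln (q uj) - ln (q ui)) = q uj - q ui.
Proof.
move=> qi qj; rewrite /lnavg; case: (eqVneq (q ui) (q uj)) => [->|nq].
  by rewrite !subrr mulr0.
by rewrite /jump divfK// subr_ln_neq0.
Qed.

Lemma lnavg_neq0 (q : state R Ni -> R) ui uj : 0 < q ui -> 0 < q uj ->
  lnavg q ui uj != 0.
Proof.
move=> qi qj; rewrite /lnavg; case: (eqVneq (q ui) (q uj)) => [_|nq].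
  by rewrite gt_eqF.
by rewrite mulf_neq0// ?invr_eq0 ?subr_ln_neq0// subr_eq0 eq_sym.
Qed.

End Components.

(** * The entropy conservation identity *)

Section EntropyConservation.
Set Implicit Arguments.
Unset Strict Implicit.
Context {R : realType} {Ni : nat}.
Variables (gam r : 'I_Ni -> R) (ch : R).
Hypothesis gam1 : forall k, 1 < gam k.
Variables (pe : state R Ni -> R) (pebar : state R Ni -> state R Ni -> R).
Implicit Types (k : 'I_Ni) (m : 'I_3) (u : state R Ni).

(** The field components of w carry the factor beta_+, the sum of the beta_k;
    distributing it makes the whole contraction a single sum over species. *)
Lemma dotp_entropy_vars u (a m1 m2 m3 e : 'I_Ni -> R) (b1 b2 b3 c : R) :
  admissible gam r u ->
  dotp (entropy_vars gam u) (vec a m1 m2 m3 e b1 b2 b3 c) =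
  \sum_k (((gam k - sk gam k u) / (gam k - 1) - beta gam k u * velsq k u) * a k
          + 2 * beta gam k u * (vel k x1 u * m1 k + vel k x2 u * m2 k
             + vel k x3 u * m3 k - e k + mag x1 u * b1 + mag x2 u * b2
             + mag x3 u * b3 + psi u * c)).
Proof.
move=> adm; rewrite (entropy_varsE gam1 adm) dotp_vecl.
rewrite /rho /mom /ener /mag /psi !field_comp_vec /=.
under eq_bigr do rewrite !ion_comp_vec /=.
rewrite -/(psi u) -!/(mag _ u) /beta_plus.
have -> x y z w b : 2 * b * x * b1 + 2 * b * y * b2 + 2 * b * z * b3
  + 2 * b * w * c = b * (2 * (x * b1 + y * b2 + z * b3 + w * c)) by ring.
rewrite mulr_suml -big_split /=; apply: eq_bigr => k _; ring.
Qed.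

Lemma beta_gt0 u k : admissible gam r u -> 0 < beta gam k u.
Proof.
by move=> [pos _]; have [? ?] := pos k; rewrite divr_gt0// mulr_gt0.
Qed.

Lemma beta_neq0 u k : admissible gam r u -> beta gam k u != 0.
Proof. by move=> adm; rewrite gt_eqF// beta_gt0. Qed.

Lemma pres_beta u k : admissible gam r u ->
  pres gam k u = rho k u / (2 * beta gam k u).
Proof.
move=> [pos _]; have [rk pk] := pos k.
by rewrite /beta; field; rewrite !gt_eqF.
Qed.

Lemma vplusk_vel k m u : vplusk r k m u = r k * rho k u / nee r u * vel k m u.
Proof. by rewrite /vplusk mulrAC. Qed.

(** The pressure work and the entropy flux cancel against the fluid part of
    w . f, and the electron pressure cancels between the momentum and energy
    rows of the Lorentz term. *)
Lemma entropy_potentialE u : admissible gam r u ->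
  entropy_potential gam r ch pe u =
  \sum_k (rho k u * vel k x1 u + beta gam k u * vplusk r k x1 u * magsq u
          + 2 * beta gam k u * ch * psi u * mag x1 u).
Proof.
move=> adm; rewrite /entropy_potential /flux /Phi /phiGP /phiLor /hLor.
rewrite /Phimulti /phiGLM !hadamard_vec !vecZ !vecD dotp_entropy_vars//.
rewrite /entropy_flux -sumrB; apply: eq_bigr => k _.
rewrite (pres_beta _ adm) /vminusk /vplusk_mag /vplus_mag /magsq /velsq !sum_dir.
rewrite !vplusk_vel.
have := beta_neq0 k adm; have := gam1 k.
set c := r k * _ / _.
move: c (vplus r x1 u) (vplus r x2 u) (vplus r x3 u).
move: (sk gam k u) (beta gam k u) => s b c vp1 vp2 vp3 g1 b0.
field.
by rewrite b0 subr_eq0 gt_eqF.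
Qed.

Lemma fluxECC ui uj : fluxEC gam r ch ui uj = fluxEC gam r ch uj ui.
Proof.
have rhoC k : f_rho ui uj k = f_rho uj ui k.
  by rewrite /f_rho lnavgC avgC.
have momC k m : f_mom gam ui uj k m = f_mom gam uj ui k m.
  by rewrite /f_mom /pbar lnavgC !(avgC _ ui uj).
have magC m : f_mag r ui uj m = f_mag r uj ui m.
  by rewrite /f_mag !(avgC _ ui uj).
rewrite /fluxEC !magC !(avgC _ ui uj); congr vec; apply/funext => k //.
rewrite /f_Euler /f_mMHD rhoC (lnavgC _ ui uj) !sum_dir !momC !magC /hk.
by rewrite !(avgC _ ui uj).
Qed.

(** Up to a constant, the logarithmic part of the density entropy variable is
    ln rho_k + ln beta_k / (gamma_k - 1), whose jump the two logarithmic means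
    make rational. *)
Lemma entropy_rho_jump ui uj k : admissible gam r ui -> admissible gam r uj ->
  lnavg (rho k) ui uj
    * ((gam k - sk gam k uj) / (gam k - 1) - (gam k - sk gam k ui) / (gam k - 1))
  = rho k uj - rho k ui + 2 * lnavg (rho k) ui uj
      * (beta gam k uj - beta gam k ui)
      * (2 * (gam k - 1) * lnavg (beta gam k) ui uj)^-1.
Proof.
move=> admi admj.
have [ri pi] := admi.1 k; have [rj pj] := admj.1 k.
have bi := beta_gt0 k admi; have bj := beta_gt0 k admj.
have skE u : 0 < rho k u -> 0 < beta gam k u -> admissible gam r u ->
    (gam k - sk gam k u) / (gam k - 1) =
    (gam k + ln 2) / (gam k - 1) + ln (rho k u) + ln (beta gam k u) / (gam k - 1).
  move=> ru bu adm; have b2 : 0 < 2 * beta gam k u by rewrite mulr_gt0.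
  rewrite /sk (pres_beta _ adm) ln_div// lnM ?posrE//; field.
  by rewrite subr_eq0 gt_eqF.
rewrite !skE// -(lnavgM (q := rho k))// -(lnavgM (q := beta gam k))//.
field; rewrite lnavg_neq0//=.
by rewrite subr_eq0 gt_eqF.
Qed.

Lemma pbarM ui uj k : admissible gam r ui -> admissible gam r uj ->
  rho k ui + rho k uj = 2 * pbar gam ui uj k * (beta gam k ui + beta gam k uj).
Proof.
move=> admi admj; rewrite /pbar /avg; field.
by rewrite gt_eqF// addr_gt0// ?(beta_gt0 k admi) ?(beta_gt0 k admj).
Qed.

(** All terms are sums over species, so it suffices that each summand vanishes.
    It does so as a polynomial identity modulo [entropy_rho_jump] and [pbarM],
    with v^+ and the electron pressures as free unknowns. *)
Lemma entropy_production_EC ui uj :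
  admissible gam r ui -> admissible gam r uj ->
  entropy_production gam r ch pe (fluxEC gam r ch) (PhiEC r pebar) ui uj = 0.
Proof.
move=> admi admj.
rewrite /entropy_production /jump dotpBl !entropy_potentialE//.
rewrite /fluxEC /PhiEC /phiGP /phiLor /hLorEC /PhimultiEC /phiGLM.
rewrite !hadamard_vec !vecZ !vecD !(dotp_entropy_vars _ _ _ _ _ _ _ _ _ admi).
rewrite !(dotp_entropy_vars _ _ _ _ _ _ _ _ _ admj).
rewrite !(avgC _ uj ui) -!sumrB -big_split -!sumrB big1// => k _.
have := entropy_rho_jump k admi admj.
have := pbarM k admi admj.
rewrite /f_Euler /f_mMHD /f_rho /f_mag /f_mom /hk !(avgC _ uj ui) /=.
set L := lnavg _ _ _; set X := (_ * _ * _)^-1.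
set P := pbar _ _ _ _; set si := (gam k - sk gam k ui) / _.
set sj := (gam k - sk gam k uj) / _.
clearbody L X P si sj.
rewrite !sum_dir /= /avg /magsq /velsq /vplusk_mag /vplus_mag !sum_dir.
rewrite /vminusk !vplusk_vel.
move: (r k * rho k ui / nee r ui) (r k * rho k uj / nee r uj) => ci cj.
move: (vplus r x1 ui) (vplus r x2 ui) (vplus r x3 ui) => pi1 pi2 pi3.
move: (vplus r x1 uj) (vplus r x2 uj) (vplus r x3 uj) => pj1 pj2 pj3.
move: (vel k x1 ui) (vel k x2 ui) (vel k x3 ui) => vi1 vi2 vi3.
move: (vel k x1 uj) (vel k x2 uj) (vel k x3 uj) => vj1 vj2 vj3.
move: (mag x1 ui) (mag x2 ui) (mag x3 ui) => Bi1 Bi2 Bi3.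
move: (mag x1 uj) (mag x2 uj) (mag x3 uj) => Bj1 Bj2 Bj3.
move: (beta gam k ui) (beta gam k uj) (psi ui) (psi uj) => bi bj qi qj.
move: (rho k ui) (rho k uj) (pebar ui uj) (pebar uj ui) => ri rj e1 e2.
move=> hP hL.
(* The coefficients of the two relations: the density flux without its factor
   L is the mean normal velocity, and pbar enters only through the normal
   momentum flux, whose test function [[2 beta v_1]] - 2 [[beta]] {{v_1}} is
   2 {{beta}} [[v_1]]. *)
set Y := (X in X = _).
have -> : Y =
    (vi1 + vj1) / 2 * (L * (sj - si) - (rj - ri + 2 * L * (bj - bi) * X))
    + (vj1 - vi1) / 2 * (2 * P * (bi + bj) - (ri + rj)).
  by rewrite /Y; field.
by rewrite hL hP !subrr !mulr0 addr0.
Qed.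

End EntropyConservation.

(** * Integration of polynomials over [-1, 1] *)

Section PolynomialIntegral.
Set Implicit Arguments.
Unset Strict Implicit.
Context {R : realType}.
Implicit Types (p q : {poly R}).

Definition pint p : R := \int[lebesgue_measure]_(x in `[-1, 1]) p.[x].

Lemma pint_deriv p : pint p^`() = p.[1] - p.[-1].
Proof.
rewrite /pint /Rintegral (@continuous_FTC2 R _ (horner p))//.
- by apply: continuous_subspaceT => x; exact: continuous_horner.
- split; first by move=> x _; exact: derivable_horner.
  + by apply: cvg_at_right_filter; exact: continuous_horner.
  + by apply: cvg_at_left_filter; exact: continuous_horner.
- by move=> x _; rewrite derivE.
Qed.

Definition primitive p := \poly_(i < (size p).+1) (p`_i.-1 / i%:R).

Lemma deriv_primitive p : (primitive p)^`() = p.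
Proof.
apply/polyP => i; rewrite coef_deriv coef_poly ltnS.
have [ip|pi] := ltnP; last by rewrite mul0rn nth_default.
by rewrite -[LHS]mulr_natr divfK// pnatr_eq0.
Qed.

(** Primitives turn linearity of the integral into linearity of evaluation, so
    that integrability never has to be discussed. *)
Lemma pint_is_linear : linear_for *%R pint.
Proof.
move=> c p q; rewrite -[in LHS](deriv_primitive p) -[in LHS](deriv_primitive q).
rewrite -derivZ -derivD -[in RHS](deriv_primitive p) -[in RHS](deriv_primitive q).
by rewrite !pint_deriv !hornerE /=; ring.
Qed.

HB.instance Definition _ :=
  GRing.isLinear.Build R {poly R} R *%R pint pint_is_linear.

Lemma size_deriv_leq p n : (size p <= n.+1)%N -> (size p^`() <= n)%N.
Proof.
move=> pn; have [->|p0] := eqVneq p 0; first by rewrite deriv0 size_poly0.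
by rewrite -ltnS (leq_trans (lt_size_deriv p0)).
Qed.

Lemma size_derivn_leq p n m : (size p <= n + m)%N -> (size p^`(n) <= m)%N.
Proof.
elim: n m => [|n IH] m; first by rewrite derivn0.
by rewrite derivnS addSnnS => /IH; exact: size_deriv_leq.
Qed.

End PolynomialIntegral.

(** * Legendre polynomials *)

Section Legendre.
Set Implicit Arguments.
Unset Strict Implicit.
Context {R : realType}.
Implicit Types (p q : {poly R}).

(** Differentiation lowers the multiplicity of a factor by at most one. *)
Lemma dvdp_deriv_exp p q n : p ^+ n.+1 %| q -> p ^+ n %| q^`().
Proof.
move=> /dvdpP [s ->]; rewrite derivM deriv_exp /= exprS dvdp_add//.
  by rewrite mulrA dvdp_mull.
by rewrite -mulrnAl mulrA dvdp_mull.
Qed.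

(** Its n-th derivative is the Legendre polynomial of degree n, up to a factor. *)
Definition rodrigues n : {poly R} := ('X^2 - 1) ^+ n.

Lemma root_derivn_rodrigues n k x : (k < n)%N -> x ^+ 2 = 1 ->
  root (rodrigues n)^`(k) x.
Proof.
move=> kn x1.
have dv : ('X^2 - 1) ^+ (n - k) %| (rodrigues n)^`(k).
  elim: k kn => [|k IH] kn; first by rewrite subn0 dvdpp.
  by rewrite derivnS dvdp_deriv_exp// subnSK 1?ltnW// IH// ltnW.
case/dvdpP: dv => s ->; rewrite /root hornerM horner_exp !hornerE x1 subrr.
by rewrite expr0n subn_eq0 leqNgt kn mulr0.
Qed.

(** Each integration by parts moves one derivative onto q, the boundary terms
    vanishing by [root_derivn_rodrigues]; q is exhausted after k steps. *)
Lemma pint_derivn_rodrigues n k q : (k <= n)%N -> (size q <= k)%N ->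
  pint (q * (rodrigues n)^`(k)) = 0.
Proof.
elim: k q => [|k IH] q kn qk.
  by move: qk; rewrite leqn0 size_poly_eq0 => /eqP ->; rewrite mul0r raddf0.
have -> : q * (rodrigues n)^`(k.+1)
    = (q * (rodrigues n)^`(k))^`() - q^`() * (rodrigues n)^`(k).
  by rewrite derivM derivnS addrC addKr.
rewrite raddfB/= pint_deriv IH ?size_deriv_leq//; last exact: ltnW.
rewrite !hornerM.
have m1 : (-1) ^+ 2 = 1 :> R by rewrite sqrrN expr1n.
have /rootP -> := root_derivn_rodrigues kn (expr1n R 2).
have /rootP -> := root_derivn_rodrigues kn m1.
by rewrite !mulr0 !subrr.
Qed.

Lemma legendre_orthogonal n q : (size q <= n)%N -> pint (q * legendre n) = 0.
Proof.
by move=> qn; rewrite -scalerAr linearZ/= pint_derivn_rodrigues ?mulr0.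
Qed.

(** The factor 1 - X^2 kills the boundary terms of one integration by parts,
    which leaves P_n tested against a polynomial of degree less than n. *)
Lemma pint_deriv_legendre n q : (size q < n)%N ->
  pint (q * ((1 - 'X^2) * (legendre n)^`())) = 0.
Proof.
move=> qn.
have -> : q * ((1 - 'X^2) * (legendre n)^`()) =
    (q * (1 - 'X^2) * legendre n)^`() - (q * (1 - 'X^2))^`() * legendre n.
  by rewrite (derivM _ (legendre n)) [RHS]addrC addKr mulrA.
rewrite raddfB/= pint_deriv legendre_orthogonal.
  have e0 x : x ^+ 2 = 1 -> (1 - 'X^2 : {poly R}).[x] = 0.
    by move=> x1; rewrite !hornerE x1 subrr.
  by rewrite !hornerM !e0 ?sqrrN ?expr1n// !mulr0 !mul0r !subr0.
apply: size_deriv_leq; rewrite (leq_trans (size_polyMleq _ _))//.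
rewrite -[1 - 'X^2]opprB size_polyN size_XnsubC//; lia.
Qed.

Definition nonneg_coefs p := forall i, 0 <= p`_i.

Lemma nonneg_coefsM p q : nonneg_coefs p -> nonneg_coefs q ->
  nonneg_coefs (p * q).
Proof.
by move=> p0 q0 i; rewrite coefM sumr_ge0// => j _; rewrite mulr_ge0.
Qed.

Lemma nonneg_coefsX p n : nonneg_coefs p -> nonneg_coefs (p ^+ n).
Proof.
move=> p0; elim: n => [|n IH]; last by rewrite exprS; exact: nonneg_coefsM.
by move=> i; rewrite coef1 ler0n.
Qed.

Lemma nonneg_coefs_gt0 p x : nonneg_coefs p -> p != 0 -> 0 < x -> 0 < p.[x].
Proof.
move=> p0 pn x0; rewrite horner_coef.
move: pn; rewrite -size_poly_gt0; case sp: (size p) => [//|n] _.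
rewrite big_ord_recr/= ltr_wpDl//.
  by rewrite sumr_ge0// => i _; rewrite mulr_ge0// exprn_ge0// ltW.
rewrite mulr_gt0 ?exprn_gt0// lt_neqAle p0 andbT eq_sym.
by have := lead_coef_eq0 p; rewrite lead_coefE sp/= => ->; rewrite -size_poly_eq0 sp.
Qed.

Lemma derivn_comp_affine p q n (c : R) : q^`() = c%:P ->
  (p \Po q)^`(n) = c ^+ n *: (p^`(n) \Po q).
Proof.
move=> qc; elim: n => [|n IH]; first by rewrite expr0 scale1r.
rewrite derivnS IH derivZ deriv_comp qc -derivnS mulrC mul_polyC scalerA.
by rewrite exprSr.
Qed.

(** In the variable y = |x| - 1, that is after the substitution
    x = +-(y + 1), the polynomial X^2 - 1 becomes X (X + 2). Its powers and all
    their derivatives have nonnegative coefficients, hence are positive for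
    y > 0 unless they vanish identically. *)
Lemma deriv_legendre_neq0 n (x : R) : (0 < n)%N -> 1 < `|x| ->
  (legendre n)^`().[x] != 0.
Proof.
move=> n0 x1; pose e : R := Num.sg x; pose y : R := `|x| - 1.
have xn0 : x != 0 by rewrite -normr_gt0 (lt_trans ltr01).
have e2 : e ^+ 2 = 1 by rewrite sqr_sg xn0.
have e0 : e != 0 by rewrite -sqrf_eq0 e2 oner_eq0.
pose q : {poly R} := e *: ('X + 1).
have qy : q.[y] = x by rewrite !hornerE subrK -numEsg.
pose g : {poly R} := ('X * ('X + 2%:P)) ^+ n.
have gE : rodrigues n \Po q = g.
  rewrite /rodrigues rmorphXn/= rmorphB/= rmorphXn/= comp_polyX rmorph1 /q.
  by rewrite exprZn e2 scale1r /g; congr (_ ^+ n); rewrite polyCD; ring.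
have g0 : nonneg_coefs g^`(n.+1).
  move=> i; rewrite coef_derivn mulrn_wge0//; apply: nonneg_coefsX.
  apply: nonneg_coefsM => {}i; first by rewrite coefX ler0n.
  by rewrite coefD coefX coefC; case: ifP; rewrite ?addr_ge0 ?ler0n.
have gn0 : g^`(n.+1) != 0.
  have m2 : 'X * ('X + 2%:P) \is @monic R by rewrite monicMl ?monicX ?monicXaddC.
  have s2 : size ('X * ('X + 2%:P) : {poly R}) = 3%N.
    by rewrite mulrC size_mulX ?size_XaddC// -size_poly_eq0 size_XaddC.
  apply/eqP => /polyP /(_ n.-1); rewrite coef_derivn coef0 addSnnS prednK//.
  have -> : (n + n = (size g).-1)%N by rewrite size_exp s2; lia.
  rewrite -lead_coefE (monicP (monic_exp _ m2)) => /eqP.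
  by rewrite pnatr_eq0 eqn0Ngt ffact_gt0 size_exp s2 => /negP; apply; lia.
rewrite /legendre derivZ hornerZ mulf_neq0//.
have := nonneg_coefs_gt0 g0 gn0 (_ : 0 < y); rewrite subr_gt0 => /(_ x1).
rewrite -gE (@derivn_comp_affine _ _ _ e); last first.
  by rewrite derivZ derivD derivX derivC addr0 alg_polyC.
rewrite hornerZ horner_comp qy derivnS => /lt0r_neq0.
by rewrite mulf_eq0 negb_or => /andP[].
Qed.

End Legendre.

(** * Interpolation at distinct nodes *)

Section Interpolation.
Set Implicit Arguments.
Unset Strict Implicit.
Context {R : realType} {N : nat}.
Variable xi : 'I_N.+1 -> R.
Hypothesis xi_inj : injective xi.
Implicit Types (p q : {poly R}).

Lemma lagrange_polyE k j : (lagrange_poly xi k).[xi j] = (k == j)%:R.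
Proof.
rewrite /lagrange_poly horner_prod; have [<-|kj] := eqVneq k j.
  apply: big1 => m mk; rewrite !hornerE mulVf// subr_eq0.
  by apply: contra mk => /eqP /xi_inj ->.
rewrite (bigD1 j) 1?eq_sym//=.
by rewrite !hornerE subrr mulr0 mul0r.
Qed.

Lemma size_lagrange_poly k : (size (lagrange_poly xi k) <= N.+1)%N.
Proof.
rewrite /lagrange_poly scaler_prod (leq_trans (size_scale_leq _ _))//.
rewrite size_prod => [|m _]; last by rewrite polyXsubC_eq0.
under eq_bigr do rewrite size_XsubC.
rewrite sum_nat_const (eq_card (B := predC1 k))// cardC1 card_ord; lia.
Qed.

Lemma poly_nodes_eq0 p : (size p <= N.+1)%N -> (forall k, p.[xi k] = 0) -> p = 0.
Proof.
move=> sp p0; apply: (@roots_geq_poly_eq0 _ p (map xi (enum 'I_N.+1))).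
- by apply/allP => _ /mapP[k _ ->]; apply/rootP.
- by rewrite map_inj_uniq ?enum_uniq.
- by rewrite size_map size_enum_ord.
Qed.

Lemma lagrange_interpolation p : (size p <= N.+1)%N ->
  p = \sum_k p.[xi k] *: lagrange_poly xi k.
Proof.
move=> sp; apply/eqP; rewrite -subr_eq0; apply/eqP/poly_nodes_eq0 => [|j].
  rewrite (leq_trans (size_polyD _ _))// geq_max sp size_polyN.
  rewrite (leq_trans (size_sum _ _ _))//; apply/bigmax_leqP => k _.
  by rewrite (leq_trans (size_scale_leq _ _)) ?size_lagrange_poly.
rewrite hornerD hornerN horner_sum (bigD1 j)//= big1 => [|k kj].
  by rewrite hornerZ lagrange_polyE eqxx mulr1 addr0 subrr.
by rewrite hornerZ lagrange_polyE (negbTE kj) mulr0.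
Qed.

Lemma sum_lagrange_poly : \sum_k lagrange_poly xi k = 1.
Proof.
rewrite [RHS]lagrange_interpolation ?size_poly1//.
by apply: eq_bigr => k _; rewrite hornerC scale1r.
Qed.

Lemma quadrature_interpolatory p : (size p <= N.+1)%N ->
  pint p = \sum_k lgl_weight xi k * p.[xi k].
Proof.
move=> sp; rewrite [in LHS](lagrange_interpolation sp) raddf_sum.
by apply: eq_bigr => k _ /=; rewrite linearZ/= mulrC.
Qed.

Definition nodal_poly : {poly R} := \prod_k ('X - (xi k)%:P).

Lemma size_nodal_poly : size nodal_poly = N.+2.
Proof.
rewrite /nodal_poly size_prod => [|k _]; last by rewrite polyXsubC_eq0.
under eq_bigr do rewrite size_XsubC.
by rewrite sum_nat_const card_ord; lia.
Qed.

Lemma nodal_polyE k : nodal_poly.[xi k] = 0.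
Proof. by rewrite /nodal_poly horner_prod (bigD1 k)//= !hornerE subrr mul0r. Qed.

End Interpolation.

(** * Legendre-Gauss-Lobatto quadrature and summation by parts *)

Section SummationByParts.
Set Implicit Arguments.
Unset Strict Implicit.
Context {R : realType} {N : nat}.
Variable xi : 'I_N.+1 -> R.
Hypotheses (N0 : (0 < N)%N) (lgl : lgl_nodes xi).
Implicit Types (p q : {poly R}).

Local Notation nodal_poly := (nodal_poly xi).

Lemma lgl_nodes_inj : injective xi.
Proof.
move=> i j xij; apply/val_inj; case: (ltngtP (val i) (val j)) => // ij.
  by have := lgl.1 _ _ ij; rewrite xij ltxx.
by have := lgl.1 _ _ ij; rewrite xij ltxx.
Qed.

(** The N + 1 nodes are distinct roots of (1 - X^2) P_N', a nonzero polynomial of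
    degree at most N + 1. *)
Lemma nodal_poly_legendre :
  exists2 c, c != 0 & (1 - 'X^2) * (legendre N)^`() = c *: nodal_poly.
Proof.
set w := _ * _.
have w0 : w != 0.
  (* Any point outside [-1, 1] witnesses this. *)
  apply/eqP => /(congr1 (horner^~ 2)); rewrite hornerM hornerC => /eqP.
  rewrite mulf_eq0 (negbTE (deriv_legendre_neq0 N0 _)) ?ger0_norm ?ltr1n//.
  by rewrite orbF !hornerE -natrX subr_eq0 (eqr_nat _ 1 4).
have sw : (size w <= N.+2)%N.
  rewrite (leq_trans (size_polyMleq _ _))// -[1 - 'X^2]opprB size_polyN.
  rewrite size_XnsubC//.
  suff : (size (legendre N : {poly R})^`() <= N)%N by [].
  rewrite size_deriv_leq// /legendre (leq_trans (size_scale_leq _ _))//.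
  rewrite size_derivn_leq//.
  by rewrite (leq_trans (size_exp_leq _ _))// size_XnsubC//=; lia.
have : nodal_poly %| w.
  rewrite /nodal_poly -(big_map xi xpredT (fun z => 'X - z%:P)) uniq_roots_dvdp//.
    by apply/allP => _ /mapP[k _ ->]; exact: lgl.2.
  rewrite uniq_rootsE map_inj_uniq ?index_enum_uniq//; exact: lgl_nodes_inj.
case/dvdpP => q wE; have q0 : q != 0.
  by apply: contra w0 => /eqP q0; rewrite wE q0 mul0r.
have n0 : nodal_poly != 0 by rewrite -size_poly_eq0 size_nodal_poly.
have : (size q <= 1)%N.
  move: sw; rewrite wE size_mul// size_nodal_poly addnS/=.
  by rewrite -(add1n N.+1) leq_add2r.
move=> /size1_polyC qE; exists q`_0; last by rewrite wE {1}qE mul_polyC.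
by move: q0; rewrite {1}qE polyC_eq0.
Qed.

(** Divide p by the nodal polynomial. The remainder is integrated exactly by
    interpolation. The quotient has degree less than N - 1, so its product with
    the nodal polynomial integrates to 0, and it also vanishes at the nodes. *)
Lemma quadrature_exact p : (size p <= N.*2)%N ->
  pint p = \sum_k lgl_weight xi k * p.[xi k].
Proof.
move=> sp; have [c c0 wE] := nodal_poly_legendre.
have n0 : nodal_poly != 0 by rewrite -size_poly_eq0 size_nodal_poly.
rewrite {1}(divp_eq p nodal_poly) raddfD/=.
have -> : pint (p %/ nodal_poly * nodal_poly) = 0.
  have := @pint_deriv_legendre R N (c^-1 *: (p %/ nodal_poly)).
  rewrite wE -scalerAl -scalerAr scalerA mulVf// scale1r; apply.
  rewrite (leq_ltn_trans (size_scale_leq _ _))// size_divp// size_nodal_poly.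
  rewrite (leq_ltn_trans (leq_sub2r _ sp))//=; lia.
rewrite add0r (quadrature_interpolatory lgl_nodes_inj); last first.
  by rewrite -ltnS -(size_nodal_poly xi) ltn_modp.
apply: eq_bigr => k _; rewrite {2}(divp_eq p nodal_poly).
by rewrite hornerD hornerM nodal_polyE mulr0 add0r.
Qed.

Lemma lgl_nodes_le1 k : `|xi k| <= 1.
Proof.
rewrite leNgt; apply/negP => x1; have /rootP := lgl.2 k.
rewrite hornerM => /eqP; rewrite mulf_eq0 (negbTE (deriv_legendre_neq0 N0 x1)).
rewrite orbF !hornerE subr_eq0 eq_sym -real_normK ?num_real// gt_eqF//.
by rewrite exprn_egt1.
Qed.

Lemma lgl_nodes_pm1 x : x ^+ 2 = 1 -> exists k, xi k = x.
Proof.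
move=> x1; have [c c0 wE] := nodal_poly_legendre.
have : root nodal_poly x.
  have /eqP := congr1 (horner^~ x) wE.
  rewrite hornerM hornerZ [X in X * _](_ : _ = 0) ?mul0r; last first.
    by rewrite !hornerE x1 subrr.
  by rewrite eq_sym mulf_eq0 (negbTE c0).
rewrite /root /nodal_poly horner_prod => /prodf_eq0[k _].
by rewrite !hornerE subr_eq0 => /eqP ->; exists k.
Qed.

Lemma lgl_nodes_le (i j : 'I_N.+1) : (i <= j)%N -> xi i <= xi j.
Proof.
rewrite leq_eqVlt => /predU1P[/val_inj ->//|ij].
by rewrite ltW// lgl.1.
Qed.

Lemma lgl_nodes_first : xi ord0 = -1.
Proof.
have [|k xk] := @lgl_nodes_pm1 (-1); first by rewrite sqrrN expr1n.
apply/le_anti; rewrite -{1}xk lgl_nodes_le//=.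
by have := lgl_nodes_le1 ord0; rewrite ler_norml => /andP[].
Qed.

Lemma lgl_nodes_last : xi ord_max = 1.
Proof.
have [|k xk] := @lgl_nodes_pm1 1; first by rewrite expr1n.
apply/le_anti; rewrite -{2}xk lgl_nodes_le ?leq_ord// andbT.
by have := lgl_nodes_le1 ord_max; rewrite ler_norml => /andP[].
Qed.

(** The symmetric part of Q is the quadrature of (l_j l_k)', a polynomial of
    degree at most 2 N - 1, so it is the exact boundary value. *)
Lemma Qmx_sbp : Qmx xi + (Qmx xi)^T = Bmx.
Proof.
apply/matrixP => j k; rewrite !mxE.
have -> : lgl_weight xi j * (lagrange_poly xi k)^`().[xi j]
        + lgl_weight xi k * (lagrange_poly xi j)^`().[xi k]
    = \sum_m lgl_weight xi m
        * ((lagrange_poly xi j * lagrange_poly xi k)^`()).[xi m].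
  under eq_bigr do rewrite derivM hornerD !hornerM
    !(lagrange_polyE lgl_nodes_inj) mulrDr.
  rewrite big_split addrC /=; congr (_ + _).
    rewrite (bigD1 k)//= eqxx mulr1 big1 ?addr0// => m mk.
    by rewrite eq_sym (negbTE mk) !mulr0.
  rewrite (bigD1 j)//= eqxx mul1r big1 ?addr0// => m mj.
  by rewrite eq_sym (negbTE mj) mul0r mulr0.
rewrite -quadrature_exact; last first.
  apply: size_deriv_leq; rewrite (leq_trans (size_polyMleq _ _))//.
  by have := size_lagrange_poly xi j; have := size_lagrange_poly xi k; lia.
have at1 l : (lagrange_poly xi l).[1] = (l == ord_max)%:R.
  by rewrite -[in LHS]lgl_nodes_last (lagrange_polyE lgl_nodes_inj).
have atN1 l : (lagrange_poly xi l).[-1] = (l == ord0)%:R.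
  by rewrite -[in LHS]lgl_nodes_first (lagrange_polyE lgl_nodes_inj).
rewrite pint_deriv !hornerM !at1 !atN1.
have e a : (j == a)%:R * (k == a)%:R = (j == a)%:R *+ (j == k) :> R.
  case: (eqVneq j a) => [->|_]; last by rewrite mul0r mul0rn.
  by rewrite mul1r eq_sym; case: (a == k).
by rewrite !e mulrnBl.
Qed.

Lemma Smx_skew j k : Smx xi k j = - Smx xi j k.
Proof.
have QB : Qmx xi j k + Qmx xi k j = Bmx j k.
  by rewrite -Qmx_sbp !mxE.
have BT : Bmx k j = Bmx j k :> R.
  by rewrite -[in LHS]Qmx_sbp -QB !mxE addrC.
have SE i l : Smx xi i l = 2 * Qmx xi i l - Bmx i l.
  by rewrite /Smx mxE [_ (2 *: _) _ _]mxE [_ (- _) _ _]mxE.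
by rewrite !SE BT -QB; ring.
Qed.

Lemma Smx_row_sum j : \sum_k Smx xi j k = (j == ord0)%:R - (j == ord_max)%:R.
Proof.
rewrite /Smx; under eq_bigr do rewrite !mxE.
rewrite sumrB -mulr_sumr -mulr_sumr -horner_sum -raddf_sum.
rewrite (sum_lagrange_poly lgl_nodes_inj)/=.
rewrite derivC horner0 !mulr0 sub0r (bigD1 j)//= eqxx mulr1n big1 => [|k kj].
  by rewrite addr0 opprB.
by rewrite [j == k]eq_sym (negbTE kj).
Qed.

End SummationByParts.

(** * Entropy balance of the scheme *)

Section DiscontinuousGalerkin.
Set Implicit Arguments.
Unset Strict Implicit.
Context {R : realType} {Ni : nat}.
Variables (gam r : 'I_Ni -> R) (ch : R).
Hypothesis gam1 : forall k, 1 < gam k.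
Variables (pe : state R Ni -> R) (pebar : state R Ni -> state R Ni -> R).

Local Notation w := (entropy_vars gam).
Local Notation f := (fluxEC gam r ch).
Local Notation Ph := (PhiEC r pebar).
Local Notation Psi := (entropy_potential gam r ch pe).
Local Notation fS := (entropy_flux_EC gam r ch pe pebar).

(** Skew-symmetry halves the sum onto the antisymmetric part of F, here a
    difference P_j - P_k whose two halves contribute equally. *)
Lemma skew_telescope n (S : 'M[R]_n) (F : 'I_n -> 'I_n -> R) (P b : 'I_n -> R) :
  (forall j k, S k j = - S j k) -> (forall j, \sum_k S j k = b j) ->
  (forall j k, F j k - F k j = P j - P k) ->
  \sum_j \sum_k S j k * F j k = \sum_j b j * P j.
Proof.
move=> skew row FP.
have anti (G : 'I_n -> 'I_n -> R) :
    \sum_j \sum_k S j k * G k j = - \sum_j \sum_k S j k * G j k.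
  rewrite exchange_big -sumrN; apply: eq_bigr => j _; rewrite -sumrN.
  by apply: eq_bigr => k _; rewrite skew mulNr.
have two0 : (2 : R) != 0 by rewrite pnatr_eq0.
apply: (mulfI two0).
transitivity (\sum_j \sum_k S j k * (F j k - F k j)).
  under [RHS]eq_bigr do (under eq_bigr do rewrite mulrBr; rewrite sumrB).
  by rewrite sumrB (anti F) opprK mulr_natl mulr2n.
under eq_bigr do under eq_bigr do rewrite FP mulrBr.
under eq_bigr do rewrite sumrB.
have -> : \sum_j b j * P j = \sum_j \sum_k S j k * P j.
  by apply: eq_bigr => j _; rewrite -mulr_suml row.
by rewrite sumrB (anti (fun j _ => P j)); ring.
Qed.

(** Tadmor's shuffle condition, extended by the non-conservative terms. *)
Lemma entropy_shuffle ui uj : admissible gam r ui -> admissible gam r uj ->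
  dotp (w uj) (f ui uj) - dotp (w ui) (f ui uj)
  + dotp (w uj) (Ph uj ui) - dotp (w ui) (Ph ui uj) = Psi uj - Psi ui.
Proof.
move=> admi admj.
have := entropy_production_EC ch gam1 pe pebar admi admj.
by rewrite /entropy_production /jump dotpBl => /eqP; rewrite subr_eq0 => /eqP.
Qed.

(** The two-point entropy flux averages the one-sided value w . (f + Phi) - Psi
    over the two states; both values agree by [entropy_shuffle]. *)
Lemma surface_entropy_flux ui uj : admissible gam r ui -> admissible gam r uj ->
  dotp (w ui) (f ui uj + Ph ui uj) = fS ui uj + Psi ui.
Proof.
move=> admi admj; have := entropy_shuffle admi admj.
rewrite /entropy_flux_EC /avgv dotpZl dotpDl dotpDr /avg; lra.
Qed.

Lemma dg_entropy_balance (N : nat) (xi : 'I_N.+1 -> R) (J : R)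
    (u : 'I_N.+1 -> state R Ni) (uL uR : state R Ni)
    (dotu : 'I_N.+1 -> state R Ni) : (0 < N)%N -> lgl_nodes xi ->
  (forall j, admissible gam r (u j)) ->
  admissible gam r uL -> admissible gam r uR ->
  dg_scheme xi J f Ph f Ph u uL uR dotu ->
  \sum_j J * lgl_weight xi j * dotp (w (u j)) (dotu j)
  = fS (u ord0) uL - fS (u ord_max) uR.
Proof.
move=> N0 lgl adm admL admR scheme.
pose F j k := dotp (w (u j)) (f (u j) (u k) + Ph (u j) (u k)).
have delta (i : 'I_N.+1) (G : 'I_N.+1 -> R) : \sum_j (j == i)%:R * G j = G i.
  rewrite (bigD1 i)//= eqxx mul1r big1 ?addr0// => j /negbTE ->.
  by rewrite mul0r.
have nodal j : J * lgl_weight xi j * dotp (w (u j)) (dotu j) =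
    (j == ord0)%:R * dotp (w (u j)) (f (u ord0) uL + Ph (u ord0) uL)
    - (j == ord_max)%:R * dotp (w (u j)) (f (u ord_max) uR + Ph (u ord_max) uR)
    - \sum_k Smx xi j k * F j k.
  have := congr1 (dotp (w (u j))) (scheme j).
  move: (f (u ord0) uL + _) (f (u ord_max) uR + _) => surfL surfR.
  rewrite dotp0r !dotpDr dotpNr !dotpZr dotp_sumr.
  under eq_bigr do rewrite dotpZr.
  by move=> balance; rewrite /F; lra.
under eq_bigr do rewrite nodal.
rewrite !sumrB !delta !surface_entropy_flux//.
rewrite (@skew_telescope _ _ F (fun j => Psi (u j)) _ (Smx_skew N0 lgl)
  (Smx_row_sum lgl)).
  under eq_bigr do rewrite mulrBl.
  by rewrite sumrB !delta; ring.
move=> j k; rewrite /F !(dotpDr _ (f _ _)) [f (u k) _]fluxECC.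
have := entropy_shuffle (adm j) (adm k); lra.
Qed.

Lemma entropy_production_ES (H : 'M[R]_(Ni * 5 + 4)) (lam : R) uL uR :
  sym_posdef H -> 0 <= lam -> admissible gam r uL -> admissible gam r uR ->
  entropy_production gam r ch pe (fluxES gam r ch H lam) Ph uL uR <= 0.
Proof.
move=> [_ posH] lam0 admL admR.
have := entropy_production_EC ch gam1 pe pebar admL admR.
rewrite /entropy_production /fluxES dotpDr dotpNr dotpZr.
set d := jump w uL uR => EC.
have dH : 0 <= dotp d (H *m d).
  have [->|d0] := eqVneq d 0; last exact/ltW/posH.
  by rewrite mulmx0 dotp0r.
have : 0 <= lam / 2 * dotp d (H *m d) by rewrite mulr_ge0// divr_ge0.
move: EC; lra.
Qed.

End DiscontinuousGalerkin.

Theorem mainTheorem5 (R : realType) (Ni : nat) (hNi : (1 <= Ni)%N)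
    (gam r : 'I_Ni -> R) (hgam : forall k, 1 < gam k) (ch : R)
    (pe : state R Ni -> R) (pebar : state R Ni -> state R Ni -> R)
    (hpe : symmetric_average (admissible gam r) pe pebar) :
  (forall (N : nat) (hN : (1 <= N)%N)
      (xi : 'I_N.+1 -> R) (hxi : lgl_nodes xi)
      (J : R) (hJ : 0 < J)
      (u : 'I_N.+1 -> state R Ni) (uL uR : state R Ni)
      (hu : forall j, admissible gam r (u j))
      (huL : admissible gam r uL) (huR : admissible gam r uR)
      (dotu : 'I_N.+1 -> state R Ni)
      (hscheme : dg_scheme xi J
         (fluxEC gam r ch) (PhiEC r pebar) (fluxEC gam r ch) (PhiEC r pebar)
         u uL uR dotu),
    \sum_(j < N.+1)
       J * lgl_weight xi j * dotp (entropy_vars gam (u j)) (dotu j)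
    = entropy_flux_EC gam r ch pe pebar (u ord0) uL
      - entropy_flux_EC gam r ch pe pebar (u ord_max) uR)
  /\
  (forall (H : 'M[R]_(Ni * 5 + 4)) (hH : sym_posdef H)
      (lam : R) (hlam : 0 <= lam)
      (uL uR : state R Ni)
      (huL : admissible gam r uL) (huR : admissible gam r uR),
    entropy_production gam r ch pe
      (fluxES gam r ch H lam) (PhiEC r pebar) uL uR <= 0).
Proof.
split=> [N hN xi hxi J hJ u uL uR hu huL huR dotu hscheme|].
  exact: dg_entropy_balance.
by move=> H hH lam hlam uL uR huL huR; exact: entropy_production_ES.
Qed.
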